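(* Let $\mathbf k$ be a field of characteristic zero, $n\ge3$, and let $g=\sum_{i=1}^n a_ix_i^2$ with all $a_i\in\mathbf k\setminus\{0\}$ be a non-degenerate quadratic form on an $n$-dimensional $\mathbf k$-vector space. Then the Lie algebra $\mathfrak{so}(g)$ can be assembled in two steps from $n(n-1)(n-2)/2$ triadons; that is, $\mathfrak{so}(g)=\mathfrak g_1+\dots+\mathfrak g_n$ with mutually compatible Lie algebra structures $\mathfrak g_\alpha$ on the vector space $|\mathfrak{so}(g)|$, and each $\mathfrak g_\alpha$ is a sum of mutually compatible triadons, the total number of triadons being $n(n-1)(n-2)/2$.
   Context: $\mathfrak{so}(g)$ is the Lie algebra of linear vector fields $X$ on the vector space such that $X(g)=0$, with the commutator of vector fields as bracket; $|\mathfrak{so}(g)|$ is its underlying vector space, of dimension $m=n(n-1)/2$. Two Lie algebra structures on the same vector space are compatible if the sum of their brackets is a Lie bracket; the sum of mutually compatible structures is the structure whose bracket is the sum of the brackets. A triadon on an $m$-dimensional space is a Lie algebra structure isomorphic to the direct sum of the $3$-dimensional Heisenberg algebra ($[\varepsilon_1,\varepsilon_2]=\varepsilon_3$, $\varepsilon_3$ central) and the $(m-3)$-dimensional abelian Lie algebra. *)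

(* Defs.v *)
From HB Require Import structures.
From mathcomp Require Import all_boot all_order all_algebra.
From mathcomp Require Import mpoly.

Set Implicit Arguments.
Unset Strict Implicit.
Unset Printing Implicit Defensive.

Import GRing.Theory.
Local Open Scope ring_scope.

Section LieStructures.
Variable k : fieldType.

Definition bracket (L : lmodType k) := L -> L -> L.

Definition lie_structure (L : lmodType k) (b : bracket L) : Prop :=
  [/\ forall x, linear (b x),
      forall y, linear (b^~ y),
      forall x, b x x = 0
    & forall x y z, b x (b y z) + b y (b z x) + b z (b x y) = 0].

Definition add_bracket (L : lmodType k) (b c : bracket L) : bracket L :=
  fun x y => b x y + c x y.

Definition sum_bracket (L : lmodType k) (I : finType) (b : I -> bracket L) :
  bracket L := fun x y => \sum_(i : I) b i x y.

Definition compatible (L : lmodType k) (b c : bracket L) : Prop :=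
  lie_structure (add_bracket b c).

Definition mutually_compatible (L : lmodType k) (I : finType)
    (b : I -> bracket L) : Prop :=
  (forall i, lie_structure (b i)) /\
  (forall i j, i != j -> compatible (b i) (b j)).

Definition lie_isomorphic (L M : lmodType k) (b : bracket L) (c : bracket M) :
    Prop :=
  exists f : {linear L -> M},
    bijective f /\ forall x y, f (b x y) = c (f x) (f y).

Definition direct_sum_bracket (L M : lmodType k) (b : bracket L)
    (c : bracket M) : bracket (L * M)%type :=
  fun x y => (b x.1 y.1, c x.2 y.2).

Definition abelian_bracket (L : lmodType k) : bracket L := fun _ _ => 0.

(* In the standard basis e1 = delta_mx 0 0, e2 = delta_mx 0 1 and
   e3 = delta_mx 0 ord_max of row vectors: [e1, e2] = e3, with e3 central. *)
Definition heisenberg_bracket : bracket 'rV[k]_3 :=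
  fun u v => (u 0 0 * v 0 1 - u 0 1 * v 0 0) *: delta_mx 0 ord_max.

(* The isomorphism with k^3 x k^(m - 3) forces L to have dimension m; the
   condition 3 <= m makes the subtraction the usual one. *)
Definition triadon (m : nat) (L : lmodType k) (b : bracket L) : Prop :=
  [/\ (3 <= m)%N, lie_structure b
    & lie_isomorphic b
        (direct_sum_bracket heisenberg_bracket
           (@abelian_bracket 'rV[k]_(m - 3)))].

End LieStructures.

Section OrthogonalLieAlgebra.
Variables (k : fieldType) (n : nat).
Implicit Types (A B : 'M[k]_n) (p : {mpoly k[n]}).

(* The linear vector field \sum_(i, j) A i j x_i d/dx_j, acting on polynomial
   functions. By linvf_inj the matrix A and the vector field determine each
   other; by linvf_comm the commutator of vector fields is the matrix
   commutator A *m B - B *m A. *)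
Definition linvf A p : {mpoly k[n]} :=
  \sum_(i < n) \sum_(j < n) A i j *: ('X_i * p^`M(j)).

Lemma linvf_is_linear A : linear (linvf A).
Proof.
move=> c p q; rewrite /linvf scaler_sumr -big_split; apply: eq_bigr => i _.
rewrite scaler_sumr -big_split; apply: eq_bigr => j _ /=.
by rewrite mderivD mderivZ mulrDr scalerDr -scalerAr !scalerA mulrC.
Qed.

HB.instance Definition _ A :=
  GRing.isLinear.Build k {mpoly k[n]} {mpoly k[n]} *:%R (linvf A)
    (linvf_is_linear A).

Lemma linvfDl c A B p : linvf (c *: A + B) p = c *: linvf A p + linvf B p.
Proof.
rewrite /linvf scaler_sumr -big_split; apply: eq_bigr => i _.
rewrite scaler_sumr -big_split; apply: eq_bigr => j _ /=.
by rewrite !mxE scalerDl scalerA.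
Qed.

Lemma linvfX A j : linvf A 'X_j = \sum_(i < n) A i j *: 'X_i.
Proof.
apply: eq_bigr => i _; rewrite (bigD1 j) //= big1 => [|l lj].
  rewrite mderivX mnm1E eqxx scale1r -{1}[U_(j)%MM]add0m addmK mpolyX0.
  by rewrite mulr1 addr0.
by rewrite mderivX mnm1E eq_sym (negPf lj) scale0r mulr0 scaler0.
Qed.

Lemma linvf_inj A B : linvf A =1 linvf B -> A = B.
Proof.
move=> eqAB; apply/matrixP => i j.
have /(congr1 (mcoeff U_(i))) := eqAB 'X_j.
rewrite !linvfX !raddf_sum /= (bigD1 i) //= [RHS](bigD1 i) //=.
rewrite !big1 ?addr0 => [|l li|l li].
- by rewrite !mcoeffZ mcoeffXU eqxx !mulr1.
- by rewrite mcoeffZ mcoeffXU (negPf li) mulr0.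
- by rewrite mcoeffZ mcoeffXU (negPf li) mulr0.
Qed.

Lemma linvfM A p q : linvf A (p * q) = linvf A p * q + p * linvf A q.
Proof.
rewrite /linvf mulr_suml mulr_sumr -big_split; apply: eq_bigr => i _.
rewrite mulr_suml mulr_sumr -big_split; apply: eq_bigr => j _ /=.
rewrite mderivM mulrDr scalerDr; congr (_ + _).
  by rewrite mulrA scalerAl.
by rewrite mulrCA scalerAr.
Qed.

Lemma linvfE A p : linvf A p = \sum_(j < n) linvf A 'X_j * p^`M(j).
Proof.
rewrite /linvf exchange_big /=; apply: eq_bigr => j _.
rewrite -/(linvf A 'X_j) linvfX mulr_suml.
by apply: eq_bigr => i _; rewrite scalerAl.
Qed.

Lemma linvf_comm A B p :
  linvf (A *m B - B *m A) p = linvf A (linvf B p) - linvf B (linvf A p).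
Proof.
have linvf2 C D : linvf C (linvf D p) = linvf (C *m D) p
    + \sum_(j < n) \sum_(l < n) linvf D 'X_j * (linvf C 'X_l * p^`M(j)^`M(l)).
  rewrite [linvf D p]linvfE linear_sum [linvf (C *m D) p]linvfE -big_split.
  apply: eq_bigr => j _ /=; rewrite linvfM; congr (_ * _ + _); last first.
    by rewrite [linvf C p^`M(j)]linvfE mulr_sumr.
  rewrite !linvfX linear_sum /=.
  under eq_bigr do rewrite linearZ /= linvfX scaler_sumr.
  rewrite exchange_big; apply: eq_bigr => i _ /=.
  rewrite mxE scaler_suml; apply: eq_bigr => l _.
  by rewrite scalerA mulrC.
have sym :
    \sum_(j < n) \sum_(l < n)
        linvf B 'X_j * (linvf A 'X_l * p^`M(j)^`M(l)) =
    \sum_(j < n) \sum_(l < n)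
        linvf A 'X_j * (linvf B 'X_l * p^`M(j)^`M(l)).
  rewrite exchange_big; apply: eq_bigr => j _; apply: eq_bigr => l _ /=.
  by rewrite mderiv_comm mulrCA.
rewrite !linvf2 sym opprD addrACA subrr addr0 [A *m B - _]addrC -scaleN1r.
by rewrite linvfDl scaleN1r addrC.
Qed.

Variable a : 'I_n -> k.

Definition diag_form : {mpoly k[n]} := \sum_(i < n) a i *: 'X_i ^+ 2.

Definition so_pred : {pred 'M[k]_n} := fun A => linvf A diag_form == 0.

Lemma so_submod_closed : submod_closed so_pred.
Proof.
have so0 : (0 : 'M[k]_n) \in so_pred.
  apply/eqP; rewrite /linvf big1 // => i _; rewrite big1 // => j _.
  by rewrite mxE scale0r.
split=> // c A B /eqP gA /eqP gB; apply/eqP.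
by rewrite linvfDl gA gB scaler0 addr0.
Qed.

HB.instance Definition _ :=
  GRing.isSubmodClosed.Build k 'M[k]_n so_pred so_submod_closed.

Record so := So { so_mx :> 'M[k]_n; so_mxP : so_mx \in so_pred }.

HB.instance Definition _ := [isSub for so_mx].
HB.instance Definition _ := [Choice of so by <:].
HB.instance Definition _ := [SubChoice_isSubLmodule of so by <:].

Lemma so_bracket_subproof (X Y : so) : X *m Y - Y *m X \in so_pred.
Proof.
apply/eqP; rewrite linvf_comm.
by rewrite (eqP (so_mxP X)) (eqP (so_mxP Y)) !linear0 addr0.
Qed.

Definition so_bracket : bracket so := fun X Y => So (so_bracket_subproof X Y).

End OrthogonalLieAlgebra.

(* Main.v *)
Require Import Defs.
From HB Require Import structures.
From mathcomp Require Import all_boot all_order all_algebra.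
From mathcomp Require Import mpoly ring.

Set Implicit Arguments.
Unset Strict Implicit.
Unset Printing Implicit Defensive.

Import GRing.Theory.
Local Open Scope ring_scope.

(** A linear vector field with matrix X annihilates g exactly when
    X_ij a_j + X_ji a_i = 0 for all i, j ([in_soP]), and in this presentation
    the commutator splits along the summation index of the matrix product:
      [X, Y]_ij = sum over alpha of (X_(i,alpha) Y_(alpha,j)
                                     - Y_(i,alpha) X_(alpha,j)).
    The alpha-th summand is a bracket g_alpha on so(g) ([vertex_bracket]),
    namely X E Y - Y E X with E the diagonal matrix unit at alpha.  For any
    diagonal D, in fact, X D Y - Y D X satisfies the Jacobi identity
    ([diagonal_lie]), just as the commutator does; as the formula is additive
    in D, the sum of two of the g_alpha is again such a bracket, whence their
    compatibility.

    Think of so(g) as having one basis vector e_p for each edge p = {i, j} of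
    the complete graph on the indices.  The bracket g_alpha only pairs two
    edges at alpha, {i, alpha} with {alpha, j}, and then gives a multiple of
    the third side {i, j} of the triangle.  Retaining the third side p only,
    for p an edge away from alpha, gives a bracket of the form
    (x, y) |-> (u x * v y - v x * u y) w where u, v are multiples of two
    coordinates and w is a third basis vector: a triadon ([wedge_triadon],
    [triad_triadon]).  All the w that occur for a given alpha are killed by
    all the u and v, so that all iterated brackets vanish and the triadons
    within g_alpha are compatible ([wedge_compatible]).

    There is one triadon for each index alpha and edge p avoiding it; counting
    from the edges gives (n - 2) * n (n - 1) / 2 of them ([card_avoids]). *)

(** * Brackets of the form (u /\ v) w *)

Section WedgeBrackets.
Variables (k : fieldType) (L : lmodType k).
Implicit Types (u v : {scalar L}) (w x y z : L) (b c : bracket L).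

Lemma lie_structure_ext b c :
  lie_structure b -> (forall x y, b x y = c x y) -> lie_structure c.
Proof.
move=> [br bl bxx jac] bc; split.
- by move=> x l y z; rewrite -!bc; exact: br.
- by move=> y l x z /=; rewrite -!bc; exact: bl.
- by move=> x; rewrite -bc.
- by move=> x y z; rewrite -!bc.
Qed.

(** All the iterated brackets in the Jacobi identity vanish separately. *)
Lemma two_step_lie b :
    (forall x, linear (b x)) -> (forall y, linear (b^~ y)) ->
    (forall x, b x x = 0) -> (forall x y z, b x (b y z) = 0) ->
  lie_structure b.
Proof. by move=> br bl bxx bb0; split=> // x y z; rewrite !bb0 !addr0. Qed.

Definition wedge_bracket u v w : bracket L :=
  fun x y => (u x * v y - v x * u y) *: w.

Lemma wedge_linearr u v w x : linear (wedge_bracket u v w x).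
Proof.
move=> l y z; rewrite /wedge_bracket !linearP /= scalerA -scalerDl.
by congr (_ *: _); ring.
Qed.

Lemma wedge_linearl u v w y : linear ((wedge_bracket u v w)^~ y).
Proof.
move=> l x z; rewrite /wedge_bracket !linearP /= scalerA -scalerDl.
by congr (_ *: _); ring.
Qed.

Lemma wedge_alt u v w x : wedge_bracket u v w x x = 0.
Proof. by rewrite /wedge_bracket mulrC subrr scale0r. Qed.

Lemma wedge_eq0r u v w x y :
  u y = 0 -> v y = 0 -> wedge_bracket u v w x y = 0.
Proof. by move=> uy vy; rewrite /wedge_bracket uy vy !mulr0 subrr scale0r. Qed.

Lemma wedge_lie u v w :
  u w = 0 -> v w = 0 -> lie_structure (wedge_bracket u v w).
Proof.
move=> uw vw; apply: two_step_lie.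
- exact: wedge_linearr.
- exact: wedge_linearl.
- exact: wedge_alt.
by move=> x y z; apply: wedge_eq0r; rewrite linearZ /= ?uw ?vw mulr0.
Qed.

Lemma wedge_compatible u v w u' v' w' :
    u w = 0 -> v w = 0 -> u w' = 0 -> v w' = 0 ->
    u' w = 0 -> v' w = 0 -> u' w' = 0 -> v' w' = 0 ->
  compatible (wedge_bracket u v w) (wedge_bracket u' v' w').
Proof.
move=> uw vw uw' vw' u'w v'w u'w' v'w'; apply: two_step_lie.
- by move=> x l y z; rewrite /add_bracket !wedge_linearr scalerDr addrACA.
- move=> y l x z; rewrite /add_bracket (wedge_linearl u) (wedge_linearl u').
  by rewrite scalerDr addrACA.
- by move=> x; rewrite /add_bracket !wedge_alt addr0.
move=> x y z; rewrite /add_bracket -[RHS]addr0.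
congr (_ + _); apply: wedge_eq0r; rewrite linearD !linearZ /=.
- by rewrite uw uw' !mulr0 addr0.
- by rewrite vw vw' !mulr0 addr0.
- by rewrite u'w u'w' !mulr0 addr0.
- by rewrite v'w v'w' !mulr0 addr0.
Qed.

(** A basis e with dual basis x identifies L with k^3 x k^(m - 3): the first
    factor is spanned by e p1, e p2 and s *: e p3, the second by the other
    basis vectors. *)
Lemma wedge_triadon (P : finType) (x : P -> {scalar L}) (e : P -> L)
    (p1 p2 p3 : P) (s : k) (b : bracket L) :
    (forall p q, x p (e q) = (p == q)%:R) ->
    (forall y z, (forall p, x p y = x p z) -> y = z) ->
    uniq [:: p1; p2; p3] -> s != 0 -> lie_structure b ->
    (forall y z, b y z = (s * (x p1 y * x p2 z - x p2 y * x p1 z)) *: e p3) ->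
  triadon #|P| b.
Proof.
move=> xe sep up s0 lieb bE.
pose rest := [seq p <- enum P | p \notin [:: p1; p2; p3]].
pose ps := [:: p1; p2; p3] ++ rest.
have ups : uniq ps.
  rewrite cat_uniq up filter_uniq ?enum_uniq // andbT /=.
  by apply/hasPn => p; rewrite mem_filter => /andP[].
have ps_all p : p \in ps by rewrite mem_cat mem_filter mem_enum andbT orbN.
have sz : size ps = #|P|.
  by rewrite cardE; apply/perm_size/uniq_perm; rewrite ?enum_uniq // => p;
    rewrite ps_all mem_enum.
have szr : size rest = (#|P| - 3)%N by rewrite -sz size_cat addKn.
have P3 : (3 <= #|P|)%N by rewrite -sz.
split=> //.
(* The third coordinate is rescaled to make the structure constant 1. *)
pose c (l : 'I_3) : k := if l == ord_max then s^-1 else 1.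
have c0 l : c l != 0 by rewrite /c; case: ifP; rewrite ?invr_eq0 ?oner_eq0.
pose h (l : 'I_3) := nth p1 [:: p1; p2; p3] l.
pose r (l : 'I_(#|P| - 3)) := nth p1 rest l.
have hh l l' : (h l == h l') = (l == l') by rewrite nth_uniq.
have rr l l' : (r l == r l') = (l == l').
  by rewrite nth_uniq ?szr // filter_uniq ?enum_uniq.
have hr l l' : (h l == r l') = false.
  apply/negbTE/eqP => E.
  have : r l' \in rest by rewrite mem_nth ?szr.
  by rewrite mem_filter -E mem_nth.
pose f y : 'rV[k]_3 * 'rV[k]_(#|P| - 3) :=
  (\row_l (c l * x (h l) y), \row_l x (r l) y).
have f_lin : linear f.
  move=> a y z; congr (_, _); apply/rowP => l; rewrite !mxE linearP //=; ring.
pose fL := GRing.isLinear.Build k L _ *:%R f f_lin.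
pose F : {linear L -> ('rV[k]_3 * 'rV[k]_(#|P| - 3))%type} := HB.pack f fL.
exists F; split.
  pose g (t : 'rV[k]_3 * 'rV[k]_(#|P| - 3)) : L :=
    \sum_l ((c l)^-1 * t.1 0 l) *: e (h l) + \sum_l t.2 0 l *: e (r l).
  have fI : injective F.
    move=> y z E; apply: sep => p.
    have {}E : f y = f z := E; have := ps_all p.
    have /rowP E1 : (f y).1 = (f z).1 by rewrite E.
    have /rowP E2 : (f y).2 = (f z).2 by rewrite E.
    rewrite mem_cat => /orP[] /(nthP p1)[i ltil <-].
      have := E1 (Ordinal ltil); rewrite !mxE; exact/mulfI/c0.
    rewrite szr in ltil.
    by have := E2 (Ordinal ltil); rewrite !mxE.
  have fK : cancel g F.
    move=> [t1 t2]; rewrite /F /= /f /g /=.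
    congr (_, _); apply/rowP => l; rewrite mxE linearD !linear_sum /=.
      rewrite [X in _ + X]big1 => [|i _]; last first.
        by rewrite linearZ /= xe hr mulr0.
      rewrite addr0 (bigD1 l) //= big1 => [|i il].
        by rewrite linearZ /= xe eqxx addr0 mulr1 mulVKf.
      by rewrite linearZ /= xe hh eq_sym (negPf il) mulr0.
    rewrite big1 => [|i _]; last first.
      by rewrite linearZ /= xe eq_sym hr mulr0.
    rewrite add0r (bigD1 l) //= big1 => [|i il].
      by rewrite linearZ /= xe eqxx addr0 mulr1.
    by rewrite linearZ /= xe rr eq_sym (negPf il) mulr0.
  by exists g => //; exact: inj_can_sym.
move=> y z; rewrite bE linearZ /= /direct_sum_bracket /abelian_bracket /f /=.
have p3E : p3 = h ord_max by [].
congr (_, _); apply/rowP => l; rewrite !mxE xe p3E; last first.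
  by rewrite eq_sym hr mulr0.
rewrite hh /c /h /= !mul1r; case: (l == _); rewrite /= ?mulr0 //.
by rewrite !mulr1 mulrC mulrA mulVf // mul1r.
Qed.
End WedgeBrackets.

(** * The vector space so(g) *)

Section SkewCoordinates.
Variables (k : fieldType) (n : nat) (a : 'I_n -> k).
Hypotheses (char_k : [pchar k] =i pred0) (a_neq0 : forall i, a i != 0).

Lemma two_neq0 : (2%:R : k) != 0.
Proof. by have := char_k 2; rewrite !inE /= => ->. Qed.

Lemma mderivXi (i p : 'I_n) : ('X_i : {mpoly k[n]})^`M(p) = (i == p)%:R.
Proof.
rewrite mderivX mnm1E; case: eqP => [->|_]; last by rewrite scale0r.
by rewrite scale1r -{1}[U_(p)%MM]add0m addmK mpolyX0.
Qed.

Lemma linvf_diag_form (A : 'M[k]_n) :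
  linvf A (diag_form a) =
  2%:R *: \sum_(i < n) \sum_(j < n) (A i j * a j) *: ('X_i * 'X_j).
Proof.
rewrite /linvf scaler_sumr; apply: eq_bigr => i _.
rewrite scaler_sumr; apply: eq_bigr => j _.
rewrite /diag_form linear_sum (bigD1 j) //= big1 => [|l lj]; last first.
  rewrite mderivZ expr2 mderivM mderivXi (negPf lj).
  by rewrite mul0r mulr0 addr0 scaler0.
rewrite addr0 mderivZ expr2 mderivM mderivXi eqxx mul1r mulr1 -mulr2n.
rewrite -scaler_nat -!scalerAr !scalerA; congr (_ *: _); ring.
Qed.

(** The polynomial A(g) / 2 is the sum of the A_ij a_j x_i x_j. Its second
    derivative in x_p, x_q is A_pq a_q + A_qp a_p, which gives one direction;
    conversely, A(g) is the total of the sum and of its copy with i and j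
    exchanged, and these cancel if A_ij a_j + A_ji a_i is always 0. *)
Lemma in_soP (A : 'M[k]_n) :
  reflect (forall i j, A i j * a j = - (A j i * a i)) (A \in so_pred a).
Proof.
apply: (iffP idP) => [/eqP | skewA].
  rewrite linvf_diag_form => /eqP; rewrite scaler_eq0 (negPf two_neq0) /=.
  move=> /eqP A0 p q; apply/eqP; rewrite -addr_eq0; apply/eqP.
  have /(congr1 (fun f => f^`M(p)^`M(q))) := A0.
  have dXX i j : ('X_i * 'X_j : {mpoly k[n]})^`M(p)^`M(q)
      = ((i == p) && (j == q))%:R + ((j == p) && (i == q))%:R.
    rewrite mderivM !mderivXi mderivD !mulr_natl mulr_natr !mderivMn !mderivXi.
    by rewrite -!mulrnA !mulnb andbC [(i == q) && _]andbC.
  have dS (S : 'I_n -> 'I_n -> k) i0 j0 :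
      \sum_i \sum_j S i j *: ((i == i0) && (j == j0))%:R
      = S i0 j0 *: (1 : {mpoly k[n]}).
    rewrite (bigD1 i0) //= (bigD1 j0) //= !eqxx.
    rewrite !big1 ?addr0 // => [i ii0|j jj0].
      by rewrite big1 // => j _; rewrite (negPf ii0) scaler0.
    by rewrite (negPf jj0) scaler0.
  rewrite !linear0 (linear_sum (mderiv p)) (linear_sum (mderiv q)) /=.
  under eq_bigr do
    rewrite (linear_sum (mderiv p)) (linear_sum (mderiv q)) /=.
  under eq_bigr do under eq_bigr do rewrite !mderivZ dXX scalerDr.
  under eq_bigr do rewrite big_split.
  rewrite big_split /= dS.
  under [X in _ + X]eq_bigr do under eq_bigr do rewrite andbC.
  rewrite dS -scalerDl => /eqP.
  by rewrite scaler_eq0 oner_eq0 orbF => /eqP.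
apply/eqP; rewrite linvf_diag_form scaler_nat mulr2n.
rewrite {2}exchange_big -big_split big1 //= => i _.
rewrite -big_split big1 //= => j _.
by rewrite [A j i * _]skewA ['X_j * _]mulrC scaleNr subrr.
Qed.

Lemma so_skew (X : so a) i j : X i j * a j = - (X j i * a i).
Proof. exact: (in_soP X (so_mxP X)). Qed.

Lemma so_diag (X : so a) i : X i i = 0.
Proof.
apply/eqP; have /eqP := so_skew X i i.
rewrite -addr_eq0 -mulrDl mulf_eq0 (negPf (a_neq0 i)) orbF -mulr2n -mulr_natl.
by rewrite mulf_eq0 (negPf two_neq0).
Qed.

Definition so_entry (i j : 'I_n) (X : so a) : k := X i j.

Lemma so_entry_linear i j : scalar (so_entry i j).
Proof. by move=> c X Y; rewrite /so_entry /= !mxE. Qed.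

HB.instance Definition _ i j :=
  GRing.isLinear.Build k (so a) k *%R (so_entry i j) (so_entry_linear i j).

Lemma so_root_subproof (i j : 'I_n) :
  delta_mx i j - (a j / a i) *: delta_mx j i \in so_pred a.
Proof.
apply/in_soP => p q; rewrite !mxE.
rewrite [(q == i) && _]andbC [(q == j) && _]andbC.
case: andP => [[/eqP -> /eqP ->]|_]; case: andP => [[/eqP ? /eqP ?]|_];
  subst; rewrite ?mulr0 ?subr0 ?sub0r ?mul0r ?oppr0 //=; field; exact: a_neq0.
Qed.

Definition so_root (i j : 'I_n) : so a := So (so_root_subproof i j).

Lemma so_entry_root p q i j :
  so_entry p q (so_root i j) =
  ((p == i) && (q == j))%:R - a j / a i * ((p == j) && (q == i))%:R.
Proof. by rewrite /so_entry /= !mxE. Qed.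

(** Together with [root_vec] and [coord], a basis of so(g) indexed by the pairs
    i < j and its dual basis. *)
Definition edge := {p : 'I_n * 'I_n | (p.1 < p.2)%N}.
Implicit Types (p q : edge).

Definition coord p := so_entry (val p).1 (val p).2.
Definition root_vec p := so_root (val p).1 (val p).2.

Lemma coord_root p q : coord p (root_vec q) = (p == q)%:R.
Proof.
rewrite /coord so_entry_root.
have -> : (p == q) = ((val p).1 == (val q).1) && ((val p).2 == (val q).2) by [].
case: p q => [[p1 p2] /= p12] [[q1 q2] /= q12].
case: (@andP (p1 == q2)) => [[/eqP p1q2 /eqP p2q1]|_]; last first.
  by rewrite mulr0n mulr0 subr0.
by move: p12; rewrite p1q2 p2q1 ltnNge ltnW.
Qed.

Lemma coord_inj (X Y : so a) : (forall p, coord p X = coord p Y) -> X = Y.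
Proof.
move=> eqXY; apply/val_inj/matrixP => i j /=.
have eq_lt (i' j' : 'I_n) : (i' < j')%N -> X i' j' = Y i' j'.
  by move=> lt_ij; exact: eqXY (exist _ (i', j') lt_ij).
case: (ltngtP i j) => [/eq_lt // | /eq_lt ltji | /val_inj ->].
  by apply: (mulIf (a_neq0 j)); rewrite (so_skew X) (so_skew Y) ltji.
by rewrite !so_diag.
Qed.

(** The order of i and j is forgotten up to a nonzero factor, so that the two
    other sides of a triangle are coordinates whatever the position of its
    apex. *)
Lemma so_entry_coord (i j : 'I_n) : i != j ->
  exists p s, [/\ s != 0, val p = (i, j) \/ val p = (j, i)
                & forall X, so_entry i j X = s * coord p X].
Proof.
rewrite -val_eqE neq_ltn => /orP[] lt_ij.
  exists (exist _ (i, j) lt_ij), 1; split; [exact: oner_neq0 | by left |].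
  by move=> X; rewrite mul1r.
exists (exist _ (j, i) lt_ij), (- (a i / a j)).
split; [by rewrite oppr_eq0 mulf_neq0 ?invr_eq0 | by right | move=> X].
apply: (mulIf (a_neq0 j)); rewrite /coord /so_entry /= so_skew.
by field; exact: a_neq0.
Qed.

Lemma card_edge : #|{: edge}| = ((n * (n - 1)) %/ 2)%N.
Proof.
rewrite subn1 divn2 -bin2 card_sig -bin2_sum big_mkord.
rewrite -sum1_card -(pair_big_dep xpredT (fun i j : 'I_n => (i < j)%N)
  (fun _ _ => 1%N)) (exchange_big_dep xpredT) //=.
apply: eq_bigr => j _; rewrite (big_ord_narrow (ltnW (ltn_ord j))).
by rewrite sum1_card card_ord.
Qed.

Definition avoids (alpha : 'I_n) p :=
  ((val p).1 != alpha) && ((val p).2 != alpha).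

(** Double counting: each of the n (n - 1) / 2 edges avoids the n - 2 indices
    that are not its ends. *)
Lemma card_avoids :
  (\sum_(alpha < n) #|avoids alpha| = (n * (n - 1) * (n - 2)) %/ 2)%N.
Proof.
have n2 : (2 %| n * (n - 1))%N.
  by rewrite dvdn2 oddM; case: n => // m; rewrite subn1 /=; case: odd.
rewrite mulnC -muln_divA // -card_edge mulnC.
under eq_bigr do rewrite -sum1_card big_mkcond /=.
rewrite exchange_big -sum_nat_const; apply: eq_bigr => p _ /=.
rewrite -big_mkcond sum1_card.
have -> : #|[pred i | p \in avoids i]| = #|~: [set (val p).1; (val p).2]|.
  apply: eq_card => i; rewrite !inE unfold_in negb_or eq_sym.
  by rewrite [X in _ && ~~ X]eq_sym.
rewrite cardsCs setCK cards2 card_ord -val_eqE neq_ltn.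
by rewrite (valP p).
Qed.

(** * The brackets g_alpha *)

Definition vertex_mx (alpha : 'I_n) (X Y : so a) : 'M[k]_n :=
  \matrix_(i, j) (X i alpha * Y alpha j - Y i alpha * X alpha j).

Lemma vertex_mx_in_so alpha X Y : vertex_mx alpha X Y \in so_pred a.
Proof.
apply/in_soP => i j; rewrite !mxE !mulrBl -!mulrA.
rewrite (so_skew X alpha j) (so_skew Y alpha j) (so_skew X alpha i).
rewrite (so_skew Y alpha i); ring.
Qed.

Definition vertex_bracket alpha : bracket (so a) :=
  fun X Y => So (vertex_mx_in_so alpha X Y).

(** In matrix form b X Y = X D Y - Y D X with D the diagonal matrix of d, and
    the Jacobi identity holds as for the commutator, the products being taken
    through D. *)
Lemma diagonal_lie (d : 'I_n -> k) (b : bracket (so a)) :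
    (forall (X Y : so a) i j,
       b X Y i j = \sum_l d l * (X i l * Y l j - Y i l * X l j)) ->
  lie_structure b.
Proof.
move=> bE.
pose D : 'M[k]_n := diag_mx (\row_l d l).
have bD X Y : so_mx (b X Y) = X *m D *m Y - Y *m D *m X.
  apply/matrixP => i j; rewrite bE !mul_mx_diag !mxE -sumrB.
  by apply: eq_bigr => l _; rewrite !mxE; ring.
split.
- move=> X c Y Z; apply/val_inj => /=; rewrite !bD /=.
  rewrite !(mulmxDr, mulmxDl) -!(scalemxAl, scalemxAr).
  by rewrite scalerBr opprD addrACA.
- move=> Y c X Z; apply/val_inj => /=; rewrite !bD /=.
  rewrite !(mulmxDr, mulmxDl) -!(scalemxAl, scalemxAr).
  by rewrite scalerBr opprD addrACA.
- by move=> X; apply/val_inj; rewrite /= bD subrr.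
move=> X Y Z; apply/val_inj => /=; rewrite !bD !(mulmxBr, mulmxBl) !mulmxA.
(* Each of the six words in X, Y, Z occurs twice, with opposite signs. *)
set XYZ := X *m _ *m _ *m _ *m _; set XZY := X *m _ *m _ *m _ *m _.
set YZX := Y *m _ *m _ *m _ *m _; set ZYX := Z *m _ *m _ *m _ *m _.
set YXZ := Y *m _ *m _ *m _ *m _; set ZXY := Z *m _ *m _ *m _ *m _.
by apply/matrixP => i j; rewrite !mxE; ring.
Qed.

(** * The triadons in g_alpha *)

(** The component of the bracket g_alpha along the third side p of the triangle
    with apex alpha. *)
Definition triad (alpha : 'I_n) p : bracket (so a) :=
  wedge_bracket (so_entry (val p).1 alpha) (so_entry alpha (val p).2)
    (root_vec p).

(** The edges at alpha are distinct from the edges avoiding alpha. *)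
Lemma triad_ends_eq0 alpha p q : avoids alpha q ->
  so_entry (val p).1 alpha (root_vec q) = 0 /\
  so_entry alpha (val p).2 (root_vec q) = 0.
Proof.
move=> /andP[/negPf q1 /negPf q2]; rewrite !so_entry_root ![alpha == _]eq_sym.
by rewrite q1 q2 !andbF mulr0n mulr0 subr0.
Qed.

Lemma triad_triadon alpha p : avoids alpha p ->
  triadon ((n * (n - 1)) %/ 2) (triad alpha p).
Proof.
move=> ap; have [kill1 kill2] := triad_ends_eq0 p ap.
have lie_t : lie_structure (triad alpha p) by exact: wedge_lie.
case: p ap lie_t {kill1 kill2} => -[i j] lt_ij /andP[/= ia ja] lie_t.
rewrite eq_sym in ja.
have ij : i != j by rewrite -val_eqE neq_ltn lt_ij.
have [q1 [s1 [s1_neq0 q1E coord1]]] := so_entry_coord ia.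
have [q2 [s2 [s2_neq0 q2E coord2]]] := so_entry_coord ja.
rewrite -card_edge.
apply: (@wedge_triadon k (so a) edge (fun p => coord p) root_vec q1 q2
          (exist _ (i, j) lt_ij) (s1 * s2)) => //.
- exact: coord_root.
- exact: coord_inj.
- move/eqP: ia => ia; move/eqP: ja => ja; move/eqP: ij => ij.
  rewrite /= !inE andbT negb_or -andbA -!val_eqE /=.
  apply/and3P; split; apply/eqP; case: q1E; case: q2E => /= e2 e1 e3;
    congruence.
- by rewrite mulf_neq0.
- move=> X Y; rewrite /triad /wedge_bracket /= !coord1 !coord2.
  by congr (_ *: _); ring.
Qed.

(** The coordinates of g_alpha along the edges at alpha vanish because the
    diagonal entries of X and Y do. *)
Lemma vertex_bracketE alpha (X Y : so a) :
  \sum_(p | avoids alpha p) triad alpha p X Y = vertex_bracket alpha X Y.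
Proof.
apply: coord_inj => q; rewrite /coord linear_sum /=.
under eq_bigr do rewrite linearZ /= -/(coord q _) coord_root.
rewrite big_mkcond (bigD1 q) //= big1 => [|p pq]; last first.
  by rewrite eq_sym (negPf pq) mulr0 if_same.
rewrite eqxx mulr1 addr0 /so_entry /= mxE.
case: ifP => [_|/negbT]; first by rewrite [X alpha _ * _]mulrC.
rewrite negb_and !negbK => /orP[] /eqP ->.
  by rewrite !so_diag !mul0r subrr.
by rewrite !so_diag !mulr0 subrr.
Qed.

Lemma sum_triadE alpha (X Y : so a) :
  sum_bracket (fun r : 'I_#|avoids alpha| => triad alpha (enum_val r)) X Y =
  vertex_bracket alpha X Y.
Proof.
rewrite -vertex_bracketE.
by symmetry; exact: (big_enum_val (A := avoids alpha)).
Qed.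

Lemma vertex_bracket_sum alpha (X Y : so a) i j :
  vertex_bracket alpha X Y i j =
  \sum_l (l == alpha)%:R * (X i l * Y l j - Y i l * X l j).
Proof.
rewrite (bigD1 alpha) //= big1 => [|l /negPf ->]; last exact: mul0r.
by rewrite eqxx mul1r addr0 mxE.
Qed.

Lemma vertex_bracket_lie alpha : lie_structure (vertex_bracket alpha).
Proof. exact/diagonal_lie/vertex_bracket_sum. Qed.

Lemma vertex_bracket_compatible alpha beta :
  compatible (vertex_bracket alpha) (vertex_bracket beta).
Proof.
apply: (@diagonal_lie (fun l => (l == alpha)%:R + (l == beta)%:R)) => X Y i j.
rewrite [LHS]mxE !vertex_bracket_sum -big_split.
by apply: eq_bigr => l _; rewrite mulrDl.
Qed.

Lemma so_bracket_local (X Y : so a) :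
  so_bracket X Y = sum_bracket vertex_bracket X Y.
Proof.
apply: coord_inj => p; rewrite /coord linear_sum /so_entry /= !mxE -sumrB.
by apply: eq_bigr => alpha _; rewrite /so_entry /= mxE.
Qed.

End SkewCoordinates.

(** * Assembling so(g) *)

Theorem mainTheorem10 (k : fieldType) (n : nat) (a : 'I_n -> k)
    (char_k : [pchar k] =i pred0) (n_ge3 : (3 <= n)%N)
    (a_neq0 : forall i, a i != 0) :
  exists (N : 'I_n -> nat)
         (t : forall alpha : 'I_n, 'I_(N alpha) -> bracket (so a)),
    let g := fun alpha : 'I_n => sum_bracket (t alpha) in
    [/\ forall alpha beta, triadon ((n * (n - 1)) %/ 2) (t alpha beta),
        forall alpha, mutually_compatible (t alpha),
        mutually_compatible g,
        forall X Y : so a, so_bracket X Y = sum_bracket g X Y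
      & (\sum_(alpha < n) N alpha = (n * (n - 1) * (n - 2)) %/ 2)%N].
Proof.
exists (fun alpha => #|avoids alpha|).
exists (fun alpha r => triad char_k a_neq0 alpha (enum_val r)) => g.
have gE alpha X Y : g alpha X Y = vertex_bracket char_k alpha X Y.
  exact: sum_triadE.
have avoidsP (alpha : 'I_n) (r : 'I_#|avoids alpha|) :
    avoids alpha (enum_val r).
  by have := enum_valP r; rewrite unfold_in.
have triadP alpha (r : 'I_#|avoids alpha|) :
    triadon ((n * (n - 1)) %/ 2) (triad char_k a_neq0 alpha (enum_val r)).
  exact/triad_triadon/avoidsP.
split=> //.
- move=> alpha; split=> [r|r r' _]; first by have [] := triadP alpha r.
  have kill p r0 := triad_ends_eq0 char_k a_neq0 p (avoidsP alpha r0).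
  by apply: wedge_compatible; apply kill.
- split=> [alpha|alpha beta _].
    exact (lie_structure_ext (vertex_bracket_lie a char_k alpha)
             (fun X Y => esym (gE alpha X Y))).
  apply (lie_structure_ext (vertex_bracket_compatible a char_k alpha beta)).
  by move=> X Y; rewrite /add_bracket !gE.
- move=> X Y; rewrite (so_bracket_local char_k a_neq0).
  by apply: eq_bigr => alpha _; rewrite gE.
exact: card_avoids.
Qed.
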